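(* Let $X$ be a real Hilbert space, let $m\ge 2$ be an integer, and let $I=\{1,2,\ldots,m\}$. Let $(F_i)_{i\in I}$ be a family of firmly nonexpansive operators from $X$ to $X$, let $x\in X$ and $(z_i)_{i\in I}$ be a family in $X$, and let, for each $i\in I$, $(z_{i,n})_{n\in\mathbb{N}}$ be a sequence in $X$ such that for all $i$ and $j$ in $I$, as $n\to\infty$, $$z_{i,n}\rightharpoonup z_i\quad\text{and}\quad F_iz_{i,n}\rightharpoonup x,$$ $$\sum_{i\in I}(z_{i,n}-F_iz_{i,n})\to -mx+\sum_{i\in I}z_i,$$ $$F_iz_{i,n}-F_jz_{j,n}\to 0.$$ Then $F_iz_i=x$ for every $i\in I$.
   Context: $X$ is a real Hilbert space with inner product $\langle\cdot,\cdot\rangle$ and induced norm $\|\cdot\|$. $\rightharpoonup$ denotes weak convergence and $\to$ denotes norm (strong) convergence. A mapping $F\colon X\to X$ is firmly nonexpansive if $\|Fx-Fy\|^2+\|(\mathrm{Id}-F)x-(\mathrm{Id}-F)y\|^2\le\|x-y\|^2$ for all $x,y\in X$, where $\mathrm{Id}$ is the identity operator. *)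

(* Defs.v *)
From HB Require Import structures.
From mathcomp Require Import all_boot all_order all_algebra sesquilinear.
From mathcomp Require Import all_classical all_reals all_analysis.

Set Implicit Arguments.
Unset Strict Implicit.
Unset Printing Implicit Defensive.

Import Order.TTheory GRing.Theory Num.Theory.
Import numFieldNormedType.Exports.

Local Open Scope classical_set_scope.
Local Open Scope ring_scope.

(* A real Hilbert space is a [completeNormedModType R] together with a
   positive definite symmetric bilinear form [ip : {dot X for idfun}] that
   induces the norm; completeness and the strong topology are then those of
   the normed module. *)
Definition induces_norm (R : realType) (X : normedModType R)
    (ip : {dot X for idfun}) : Prop :=
  forall u : X, `|u| = Num.sqrt (ip u u).

Definition weakly_cvg (R : realType) (X : normedModType R)
    (ip : {dot X for idfun}) (u : nat -> X) (l : X) : Prop :=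
  forall v : X, ip (u n) v @[n --> \oo] --> ip l v.

Definition firmly_nonexpansive (R : realType) (X : normedModType R)
    (F : X -> X) : Prop :=
  forall x y : X,
    `|F x - F y| ^+ 2 + `|(x - F x) - (y - F y)| ^+ 2 <= `|x - y| ^+ 2.

(* Main.v *)
Require Import Defs.
From HB Require Import structures.
From mathcomp Require Import all_boot all_order all_algebra sesquilinear.
From mathcomp Require Import all_classical all_reals all_analysis.
From mathcomp Require Import ring lra.

Set Implicit Arguments.
Unset Strict Implicit.
Unset Printing Implicit Defensive.

Import Order.TTheory GRing.Theory Num.Theory.
Import numFieldNormedType.Exports.

Local Open Scope classical_set_scope.
Local Open Scope ring_scope.

(* Put [p_(i,n) = F_i z_(i,n)], [q_(i,n) = z_(i,n) - p_(i,n)] and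
   [a_i = F_i z_i].  Monotonicity of the pair [(F_i, Id - F_i)] at the points
   [z_(i,n)] and [z_i], summed over [i], gives
   [0 <= sum_i <p_(i,n) - a_i, q_(i,n) - (z_i - a_i)>].  The only terms that are
   not linear in the weakly convergent sequences are
   [sum_i <p_(i,n), q_(i,n)> = <p_(k,n), sum_i q_(i,n)>
     + sum_i <p_(i,n) - p_(k,n), q_(i,n)>] for any fixed [k]; each is a product
   of a weakly and a strongly convergent sequence, so it converges to the product
   of the limits.  Passing to the limit yields [0 <= - sum_i |x - a_i|^2]. *)

Section RealInnerProduct.
Variables (R : realType) (X : normedModType R) (ip : {dot X for idfun}).
Hypothesis ip_norm : induces_norm ip.

Lemma ip_sym (u v : X) : ip u v = ip v u.
Proof. by rewrite hermC expr0 mul1r. Qed.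

Lemma ip_ge0 (u : X) : 0 <= ip u u.
Proof.
have [->|u0] := eqVneq u 0; first by rewrite linear0r.
exact/ltW/neq0_dnorm_gt0.
Qed.

Lemma ip_normE (u : X) : ip u u = `|u| ^+ 2.
Proof. by rewrite ip_norm sqr_sqrtr ?ip_ge0. Qed.

Lemma cauchy_schwarz (u v : X) : `|ip u v| <= `|u| * `|v|.
Proof.
rewrite -ler_sqr ?nnegrE ?mulr_ge0// exprMn -!ip_normE real_normK ?num_real//.
have [->|v0] := eqVneq v 0; first by rewrite !linear0r expr0n.
(* This vector is [ip v v] times the component of [u] orthogonal to [v]; its square norm is [ip v v]
   times the Gram determinant of [u] and [v]. *)
have := ip_ge0 (ip v v *: u - ip u v *: v).
rewrite linearBl !linearBr !linearZl_LR !linearZr_LR /GRing.scale /= (ip_sym v u).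
rewrite (_ : _ - _ = ip v v * (ip u u * ip v v - ip u v ^+ 2)); last by ring.
by rewrite pmulr_rge0 ?subr_ge0// neq0_dnorm_gt0.
Qed.

(** Expanding [|a + b|^2] with [a + b = u - v] turns firm nonexpansiveness into [0 <= 2 <a, b>]. *)
Lemma firmly_nonexpansive_monotone (F : X -> X) (u v : X) :
  firmly_nonexpansive F -> 0 <= ip (F u - F v) ((u - F u) - (v - F v)).
Proof.
move=> /(_ u v); set a := F u - F v; set b := (u - F u) - (v - F v).
have -> : u - v = a + b.
  have -> : b = (u - v) - a by rewrite /b opprD addrACA -opprD.
  by rewrite [RHS]addrC subrK.
by clearbody a b; rewrite -!ip_normE linearDl !linearDr /= (ip_sym b a); lra.
Qed.

Lemma weakly_cvgB (u v : nat -> X) (a b : X) :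
  weakly_cvg ip u a -> weakly_cvg ip v b ->
  weakly_cvg ip (fun n => u n - v n) (a - b).
Proof.
move=> ua vb w; rewrite linearBl; under eq_fun do rewrite linearBl.
by apply: cvgB; [exact: ua|exact: vb].
Qed.

Lemma bounded_ip_cvg0 (u v : nat -> X) (M : R) :
  (forall n, `|u n| <= M) -> v n @[n --> \oo] --> (0 : X) ->
  ip (u n) (v n) @[n --> \oo] --> (0 : R).
Proof.
move=> uM v0; apply/norm_cvg0P.
apply: (@squeeze_cvgr _ _ _ _ (fun=> 0) (fun n => M * `|v n|)).
- near=> n; rewrite normr_ge0/=.
  by apply: (le_trans (cauchy_schwarz _ _)); apply: ler_wpM2r.
- exact: cvg_cst.
- rewrite -(mulr0 M) -[in X in _ --> X](normr0 X).
  by apply: cvgM; [exact: cvg_cst|exact: cvg_norm].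
Unshelve. all: by end_near. Qed.

End RealInnerProduct.

(** Uniform boundedness principle for the functionals [ip (u n)]: they are pointwise bounded because
    convergent real sequences are bounded. Completeness of [X] enters here. *)
Lemma weakly_cvg_bounded (R : realType) (X : completeNormedModType R)
    (ip : {dot X for idfun}) (u : nat -> X) (a : X) :
  induces_norm ip -> weakly_cvg ip u a -> exists M, forall n, `|u n| <= M.
Proof.
move=> ip_norm ua.
pose T : set (X -> R^o) := range (fun n => ip (u n)).
have Tlin f : T f -> bounded_fun_norm f /\ linear f.
  move=> [n _ <-]; split=> [r|c v w]; last by rewrite linearDr linearZr_LR.
  exists (`|u n| * r) => v vr.
  by apply: (le_trans (cauchy_schwarz ip_norm _ _)); apply: ler_wpM2l.
have Tptw : pointwise_bounded T.
  move=> v; have /cvg_seq_bounded [M [_ HM]] : cvg (ip (u n) v @[n --> \oo]).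
    by apply/cvg_ex; exists (ip a v); exact: ua.
  by exists (M + 1) => _ [n _ <-]; apply: HM; rewrite ?ltrDl.
have [M HM] := Banach_Steinhauss Tlin Tptw 1.
(* [M] bounds all the functionals on the closed unit ball; at the normalized vector [u n / |u n|]
   the n-th one equals [|u n|]. The maximum with 0 covers [u n = 0]. *)
exists (Num.max M 0) => n; rewrite le_max.
have [->|un0] := eqVneq (u n) 0; first by rewrite normr0 lexx orbT.
have n0 : 0 < `|u n| by rewrite normr_gt0.
have := HM (ip (u n)) (ex_intro2 _ _ n I erefl) (`|u n|^-1 *: u n).
rewrite normrZ normfV normr_id mulVf ?gt_eqF// => /(_ (lexx _)).
rewrite linearZr_LR/= (ip_normE ip_norm) expr2 mulKf ?gt_eqF// normr_id => ->.
by [].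
Qed.

(** Split [v n] as [(v n - b) + b]: the first part pairs a bounded sequence with a null one, the
    second is weak convergence tested at [b]. *)
Lemma weak_strong_cvg (R : realType) (X : completeNormedModType R)
    (ip : {dot X for idfun}) (u v : nat -> X) (a b : X) :
  induces_norm ip -> weakly_cvg ip u a -> v n @[n --> \oo] --> b ->
  ip (u n) (v n) @[n --> \oo] --> ip a b.
Proof.
move=> ip_norm ua vb; have [M uM] := weakly_cvg_bounded ip_norm ua.
have -> : (fun n => ip (u n) (v n)) =
          (fun n => ip (u n) (v n - b) + ip (u n) b).
  by apply/funext => n; rewrite linearBr subrK.
rewrite -[ip a b]add0r; apply: cvgD; last exact: ua.
by apply: bounded_ip_cvg0 uM _ => //; apply/subr_cvg0.
Qed.

Section WeakLimits.
Variables (R : realType) (X : completeNormedModType R).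
Variables (ip : {dot X for idfun}) (I : finType) (k : I).
Variables (p q : I -> nat -> X) (x : X) (y : I -> X).
Hypothesis ip_norm : induces_norm ip.
Hypothesis p_cvg : forall i, weakly_cvg ip (p i) x.
Hypothesis q_cvg : forall i, weakly_cvg ip (q i) (y i).
Hypothesis q_sum : \sum_i q i n @[n --> \oo] --> \sum_i y i.
Hypothesis p_dist : forall i, p i n - p k n @[n --> \oo] --> (0 : X).

Lemma sum_ip_cvg :
  \sum_i ip (p i n) (q i n) @[n --> \oo] --> \sum_i ip x (y i).
Proof.
have -> : (fun n => \sum_i ip (p i n) (q i n)) = (fun n =>
    ip (p k n) (\sum_i q i n) + \sum_i ip (q i n) (p i n - p k n)).
  apply/funext => n; rewrite linear_sumr -big_split/=; apply: eq_bigr => i _.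
  by rewrite linearBr (ip_sym ip (p k n)) [RHS]addrC subrK ip_sym.
have -> : \sum_i ip x (y i) = ip x (\sum_i y i) + \sum_i ip (y i) 0.
  by rewrite linear_sumr [X in _ + X]big1 ?addr0// => i _; rewrite linear0r.
apply: cvgD; first exact: weak_strong_cvg ip_norm (@p_cvg k) q_sum.
apply: (cvg_big add_continuous) => i _.
exact: weak_strong_cvg ip_norm (@q_cvg i) (@p_dist i).
Qed.

Lemma sum_ip_shift_cvg (a b : I -> X) :
  \sum_i ip (p i n - a i) (q i n - b i) @[n --> \oo]
    --> \sum_i ip (x - a i) (y i - b i).
Proof.
(* Isolates [ip u v], whose sum over the indices is handled by [sum_ip_cvg]; the other two terms
   pair a weakly convergent sequence with a fixed vector. *)
have shiftE (u v c d : X) :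
    ip (u - c) (v - d) = ip u v - (ip u d + ip (v - d) c).
  by rewrite linearBl linearBr /= (ip_sym ip c) opprD addrA.
under eq_fun do (under eq_bigr do rewrite shiftE; rewrite sumrB).
under eq_bigr do rewrite shiftE.
rewrite sumrB; apply: cvgB; first exact: sum_ip_cvg.
apply: (cvg_big add_continuous) => i _; apply: cvgD; first exact: p_cvg.
by apply: weakly_cvgB (@q_cvg i) _ _ => v; exact: cvg_cst.
Qed.

End WeakLimits.

Theorem theorem3p1 (R : realType) (X : completeNormedModType R)
    (ip : {dot X for idfun}) (ip_norm : induces_norm ip)
    (m : nat) (hm : (2 <= m)%N)
    (F : 'I_m -> X -> X) (hF : forall i, firmly_nonexpansive (F i))
    (x : X) (z : 'I_m -> X) (zn : 'I_m -> nat -> X)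
    (hz : forall i, weakly_cvg ip (zn i) (z i))
    (hFz : forall i, weakly_cvg ip (fun n => F i (zn i n)) x)
    (hsum : \sum_(i < m) (zn i n - F i (zn i n)) @[n --> \oo] -->
              - (m%:R *: x) + \sum_(i < m) z i)
    (hdiff : forall i j, F i (zn i n) - F j (zn j n) @[n --> \oo] --> (0 : X)) :
  forall i, F i (z i) = x.
Proof.
pose a i := F i (z i).
have q_cvg i : weakly_cvg ip (fun n => zn i n - F i (zn i n)) (z i - x) :=
  weakly_cvgB (hz i) (hFz i).
have q_sum : \sum_(i < m) (zn i n - F i (zn i n)) @[n --> \oo] -->
    \sum_(i < m) (z i - x).
  by rewrite sumrB sumr_const card_ord -scaler_nat addrC.
(* The reference index [k] is 0, which is below [m] by [hm]; [b i] is [Id - F i] at [z i]. *)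
have := sum_ip_shift_cvg ip_norm hFz q_cvg q_sum
  (fun i => hdiff i (Ordinal (ltnW hm))) (a := a) (b := fun i => z i - a i).
(* The second argument collapses to [a i - x], so the limit is minus a sum of squares. *)
have -> : \sum_(i < m) ip (x - a i) (z i - x - (z i - a i)) =
    - \sum_(i < m) ip (x - a i) (x - a i).
  rewrite -sumrN; apply: eq_bigr => i _; rewrite -linearNr; congr (ip _ _).
  by rewrite !opprB addrC addrA subrK.
move=> lim_cvg.
have sum_le0 : \sum_(i < m) ip (x - a i) (x - a i) <= 0.
  rewrite -oppr_ge0 -(cvg_lim _ lim_cvg)//.
  apply: limr_ge; first by apply/cvg_ex; eexists; exact: lim_cvg.
  near=> n; apply: sumr_ge0 => i _.
  exact: firmly_nonexpansive_monotone.
(* Each square is at most the whole sum of squares, hence zero. *)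
move=> i; apply/esym/eqP.
rewrite -subr_eq0 -normr_eq0 -sqrf_eq0 -(ip_normE ip_norm).
rewrite eq_le ip_ge0 andbT; apply: le_trans sum_le0.
by rewrite (bigD1 i)//= lerDl sumr_ge0// => j _; exact: ip_ge0.
Unshelve. all: by end_near. Qed.
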